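(* Let $t\geq 3$ be an integer, and let $G$ be a graph on $n$ vertices with $\alpha(G)\leq t$ and ${\Delta}_t^{\sf star}(G)=g$. Then $$(2t-3)\,{\rm b}^{\ast}(G)\leq (t-2)n+(t-1)\chi(G)+g(t-2).$$
   Context: All graphs are finite, undirected, without loops or multiple edges, with at least one vertex. $\chi(G)$ is the chromatic number, $\alpha(G)$ the maximum size of an independent set of $G$, and $N(u)$ the set of neighbors of $u$. Let $c$ be a proper vertex coloring of $G$ using $k$ colors (every one of the $k$ colors is used). A vertex $u$ is a b-vertex (of $c$) if for each color $j\neq c(u)$, $u$ has a neighbor of color $j$. A vertex $u$ is a nice vertex (of $c$) if for each color $j\neq c(u)$, $u$ has a neighbor of color $j$ which is itself a b-vertex. The coloring $c$ is a ${\rm b}^{\ast}$-coloring if it has at least one nice vertex. The ${\rm b}^{\ast}$-chromatic number ${\rm b}^{\ast}(G)$ is the maximum number of colors used in a ${\rm b}^{\ast}$-coloring of $G$. For a vertex $u$ of $G$, the $t$-star-degree $d_t^{\sf star}(u)$ is the maximum integer $d\ge 0$ for which there is a subset $D\subseteq N(u)$ with $|D|=dt$ that can be partitioned into $d$ (vertex-disjoint) independent sets of $G$, each of size $t$. The maximum $t$-star-degree of $G$ is ${\Delta}_t^{\sf star}(G)=\max_{u\in V(G)} d_t^{\sf star}(u)$. *)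

(* Defs.v *)
From mathcomp Require Import all_boot.

Set Implicit Arguments.
Unset Strict Implicit.
Unset Printing Implicit Defensive.

(* Finite simple graphs with at least one vertex. *)
Record sgraph := SGraph {
  vertex :> finType;
  adj : rel vertex;
  adj_sym : symmetric adj;
  adj_irrefl : irreflexive adj;
  vertex_gt0 : 0 < #|vertex|
}.

Section Graph.
Variable G : sgraph.

Definition nbrs (u : G) : {set G} := [set v | adj u v].

Definition independent (S : {set G}) : bool :=
  [forall x in S, forall y in S, ~~ adj x y].

Definition alpha : nat := \max_(S : {set G} | independent S) #|S|.

(* Proper colorings using exactly k colors: the map is onto 'I_k. *)
Definition proper_coloring (k : nat) (c : {ffun G -> 'I_k}) : bool :=
  [forall x, forall y, adj x y ==> (c x != c y)]
  && [forall j, exists x, c x == j].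

Definition colorable (k : nat) : bool :=
  [exists c : {ffun G -> 'I_k}, proper_coloring c].

Lemma colorable_ex : exists k, colorable k.
Proof.
exists #|G|; apply/existsP; exists [ffun x => enum_rank x].
apply/andP; split.
  apply/forallP=> x; apply/forallP=> y; apply/implyP=> exy.
  rewrite !ffunE; apply/eqP=> /enum_rank_inj exy1.
  by rewrite exy1 adj_irrefl in exy.
by apply/forallP=> j; apply/existsP; exists (enum_val j); rewrite ffunE enum_valK.
Qed.

Definition chi : nat := ex_minn colorable_ex.

Definition b_vertex (k : nat) (c : {ffun G -> 'I_k}) (u : G) : bool :=
  [forall j, (j != c u) ==> [exists v in nbrs u, c v == j]].

Definition nice_vertex (k : nat) (c : {ffun G -> 'I_k}) (u : G) : bool :=
  [forall j, (j != c u) ==>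
     [exists v in nbrs u, (c v == j) && b_vertex c v]].

Definition bstar_coloring (k : nat) (c : {ffun G -> 'I_k}) : bool :=
  proper_coloring c && [exists u, nice_vertex c u].

(* The range k <= #|G| is no restriction, since all k colors are used; the
   maximum is over a nonempty set, since some chi-coloring has a nice vertex. *)
Definition bstar : nat :=
  \max_(k < #|G|.+1 | [exists c : {ffun G -> 'I_k}, bstar_coloring c]) k.

(* D is a set of d * t neighbors of u that is partitioned into d independent
   sets of size t. *)
Definition has_star (t : nat) (u : G) (d : nat) : bool :=
  [exists D : {set G}, exists P : {set {set G}},
     [&& D \subset nbrs u, #|D| == d * t, partition P D, #|P| == d
       & [forall B in P, independent B && (#|B| == t)]]].

(* For t > 0, has_star t u d forces d <= #|G|, so the range is no restriction;
   d = 0 always qualifies (D and P empty). *)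
Definition star_degree (t : nat) (u : G) : nat :=
  \max_(d < #|G|.+1 | has_star t u d) d.

Definition max_star_degree (t : nat) : nat := \max_(u : G) star_degree t u.

End Graph.

(* Main.v *)
Require Import Defs.
From mathcomp Require Import all_boot.
From mathcomp Require Import zify.

(** Let [c] be a b*-coloring with [k] colors and nice vertex [u]. Choose in each
    color class a b-vertex, namely [u] in its own class and a neighbor of [u] in
    the others. Let [A] consist of the color of [u] and the colors used only
    once, and put [q = #|A|]. Counting vertices gives [2 k <= n + q]. A chosen
    vertex with color in [A] is adjacent to all other chosen vertices, so an
    optimal coloring spends [q] colors on those and has at most [chi - q] colors
    for the [k - q] other chosen vertices. These lie in [N(u)], so at most [g] of
    their color classes reach size [t], whence
    [k - q <= (t - 1) (chi - q) + g]. *)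

Lemma independent_card_le_alpha (G : sgraph) (S : {set G}) :
  independent S -> #|S| <= alpha G.
Proof. by move=> indS; rewrite /alpha (bigD1 S) //= leq_maxl. Qed.

Lemma star_partition_card_le (G : sgraph) (t : nat) (u : G) (P : {set {set G}}) :
  0 < t -> trivIset P -> cover P \subset nbrs u ->
  {in P, forall B, independent B && (#|B| == t)} ->
  #|P| <= max_star_degree G t.
Proof.
move=> t_gt0 triP subP starP.
have partP : partition P (cover P).
  rewrite /partition eqxx triP /=; apply/negP => /starP /andP[_].
  by rewrite cards0 eq_sym; apply/negP; rewrite -lt0n.
have cardP : #|cover P| = #|P| * t.
  by apply: card_uniform_partition => // B /starP /andP[_ /eqP].
have leG : #|P| < #|G|.+1.
  by rewrite ltnS (leq_trans (leq_pmulr _ t_gt0)) // -cardP max_card.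
apply: leq_trans (leq_bigmax u); rewrite /star_degree.
rewrite (bigD1 (Ordinal leG)) /= ?leq_maxl //.
apply/existsP; exists (cover P); apply/existsP; exists P.
rewrite subP cardP partP !eqxx /=.
by apply/forallP => B; apply/implyP => /starP.
Qed.

(** The fibers of [f] on [R] are independent, so each has at most [t] elements. Those with exactly
    [t] form a star at [u], so each fiber is charged [t - 1], plus one if it is full. *)
Lemma card_nbrs_subset_le (G : sgraph) (t : nat) (u : G) (R : {set G})
    (T : finType) (f : G -> T) :
  0 < t -> alpha G <= t -> R \subset nbrs u ->
  (forall x y, adj x y -> f x != f y) ->
  #|R| <= (t - 1) * #|f @: R| + max_star_degree G t.
Proof.
move=> t_gt0 alphaG subR propf.
set Q := preim_partition f R.
have partQ : partition Q R by apply: preim_partitionP.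
have indQ B : B \in Q -> independent B.
  case/imsetP => z _ ->; apply/forall_inP => x; rewrite inE => /andP[_ /eqP zx].
  apply/forall_inP => y; rewrite inE => /andP[_ /eqP zy].
  by apply/negP => /propf; rewrite -zx -zy eqxx.
have cardQ : #|Q| <= #|f @: R|.
  (* The block of [x] depends only on [f x]. *)
  have -> : Q = (fun j => [set y in R | j == f y]) @: (f @: R).
    by rewrite -imset_comp.
  exact: leq_imset_card.
pose P := [set B in Q | #|B| == t].
have subPQ : P \subset Q by apply/subsetP => B; rewrite inE => /andP[].
have cardP : #|P| <= max_star_degree G t.
  apply: (@star_partition_card_le _ _ u) => //.
  - by apply: trivIsetS subPQ _; case/and3P: partQ.
  - apply: subset_trans subR; rewrite -(cover_partition partQ).
    by apply/bigcupsP => B /(subsetP subPQ) QB; apply: bigcup_sup.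
  - by move=> B; rewrite inE => /andP[/indQ -> ->].
have : #|R| <= \sum_(B in Q) ((t - 1) + (#|B| == t)).
  rewrite (card_partition partQ); apply: leq_sum => B /indQ indB.
  have := leq_trans (independent_card_le_alpha _ _ indB) alphaG.
  by case: eqP => /=; lia.
rewrite big_split /= sum_nat_const -big_mkcondr /= sum1dep_card -/P.
move=> le_R; apply: leq_trans le_R _.
by rewrite leq_add // mulnC leq_mul2l cardQ orbT.
Qed.

(** Each class is nonempty, and adding one for a singleton raises its count to 2. *)
Lemma double_colors_le (T : finType) (k : nat) (c : T -> 'I_k) :
  (forall j, exists x, c x == j) ->
  2 * k <= #|T| + #|[set j | #|c @^-1: [set j]| == 1]|.
Proof.
move=> onto.
have -> : #|T| = \sum_(j < k) #|c @^-1: [set j]|.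
  rewrite -sum1_card (partition_big c predT) //=; apply: eq_bigr => j _.
  by rewrite -sum1_card; apply: eq_bigl => x; rewrite !inE.
rewrite -sum1dep_card [X in _ + X]big_mkcond -big_split /=.
have -> : 2 * k = \sum_(j < k) 2 by rewrite sum_nat_const card_ord mulnC.
apply: leq_sum => j _; have [x xj] := onto j.
have : 0 < #|c @^-1: [set j]| by apply/card_gt0P; exists x; rewrite !inE.
by case: #|_| => [|[|m]].
Qed.

Lemma nice_vertex_b_vertex (G : sgraph) (k : nat) (c : {ffun G -> 'I_k}) (u : G) :
  nice_vertex c u -> b_vertex c u.
Proof.
move=> /forallP nu; apply/forallP => j; apply/implyP => /(implyP (nu j)).
by case/existsP => v /and3P[uv cv _]; apply/existsP; exists v; rewrite uv.
Qed.

Lemma nice_vertex_representatives (G : sgraph) (k : nat) (c : {ffun G -> 'I_k})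
    (u : G) :
  nice_vertex c u ->
  exists v : 'I_k -> G, forall j,
    [/\ c (v j) = j, b_vertex c (v j), j = c u -> v j = u
      & j != c u -> adj u (v j)].
Proof.
move=> nu; apply: (@fin_all_exists _ _ (fun j w =>
  [/\ c w = j, b_vertex c w, j = c u -> w = u & j != c u -> adj u w])) => j.
have [->|ju] := eqVneq j (c u).
  by exists u; split; rewrite ?eqxx //; apply: nice_vertex_b_vertex.
have /existsP[w /and3P[uw /eqP cw bw]] := implyP (forallP nu j) ju.
rewrite inE in uw.
by exists w; split=> // /eqP; rewrite (negbTE ju).
Qed.

Lemma bstar_coloring_bound (G : sgraph) (t k : nat) (c : {ffun G -> 'I_k}) :
  3 <= t -> alpha G <= t -> bstar_coloring c ->
  (2 * t - 3) * k <=
    (t - 2) * #|G| + (t - 1) * chi G + max_star_degree G t.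
Proof.
move=> t_ge3 alphaG /andP[/andP[propc ontoc] /existsP[u nu]].
have [v vP] := nice_vertex_representatives _ _ _ _ nu.
have v_inj : injective v.
  by apply: (can_inj (g := c)) => j; case: (vP j).
(* Including [c u] in [A] ensures that every representative outside [A] is a neighbor of [u]. *)
pose S := [set j | #|c @^-1: [set j]| == 1]; pose A := c u |: S.
have leSA : #|S| <= #|A| by rewrite subset_leq_card // subsetUr.
have card_colors : 2 * k <= #|G| + #|S|.
  by apply: double_colors_le => j; apply/existsP; apply: (forallP ontoc).
(* If [i = c u], then [v i = u] and [v j] was chosen in its neighborhood. Otherwise [v i] is the
   only vertex of color [i], and the b-vertex [v j] must see that color. *)
have adjA i j : i \in A -> i != j -> adj (v i) (v j).
  case: (vP i) (vP j) => ci _ iu _ [cj bj _ uj].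
  rewrite !inE => /orP[/eqP icu ij|/cards1P[z Sz] ij].
    by rewrite (iu icu) uj // -icu eq_sym.
  have inz x : (c x == i) = (x == z).
    by have /setP/(_ x) := Sz; rewrite !inE.
  have /existsP[w] : [exists w in nbrs (v j), c w == i].
    by apply: (implyP (forallP bj i)); rewrite cj.
  rewrite inE inz => /andP[jw /eqP wz]; rewrite wz in jw.
  have /eqP -> : v i == z by rewrite -inz ci.
  by rewrite adj_sym.
have [f /andP[propf _]] : exists f : {ffun G -> 'I_(chi G)}, proper_coloring f.
  by rewrite /chi; case: ex_minnP => m /existsP.
have {}propf x y : adj x y -> f x != f y.
  by move=> xy; apply: (implyP (forallP (forallP propf x) y)).
have card_fA : #|f @: (v @: A)| = #|A|.
  rewrite -imset_comp card_in_imset // => i j Ai _ /= fij.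
  by apply/eqP; apply: contraT => /(adjA _ _ Ai)/propf; rewrite fij eqxx.
pose R := v @: ~: A.
have cardR : #|A| + #|R| = k by rewrite card_imset // cardsC card_ord.
have subR : R \subset nbrs u.
  apply/subsetP => _ /imsetP[j jA ->]; rewrite inE; case: (vP j) => _ _ _; apply.
  by move: jA; rewrite !inE negb_or => /andP[].
have card_f : #|A| + #|f @: R| <= chi G.
  rewrite -card_fA -[leqRHS]card_ord -cardsUI.
  have -> : f @: (v @: A) :&: f @: R = set0.
    apply/setP => z; rewrite !inE; apply/negP => /andP[].
    case/imsetP => _ /imsetP[i Ai ->] -> /imsetP[_ /imsetP[j jA ->]] fij.
    have ij : i != j by apply: contraTneq Ai => ->; rewrite inE in jA.
    by have := propf _ _ (adjA i j Ai ij); rewrite fij eqxx.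
  by rewrite cards0 addn0 max_card.
have cardR_le : #|R| <= (t - 1) * #|f @: R| + max_star_degree G t.
  by apply: (@card_nbrs_subset_le _ _ u) => //; lia.
(* Writing [t = s + 2] removes truncated subtraction. *)
have [s ts] : exists s, t = s + 2 by exists (t - 2); lia.
subst t.
have -> : 2 * (s + 2) - 3 = 2 * s + 1 by lia.
have -> : s + 2 - 2 = s by lia.
have es : s + 2 - 1 = s + 1 by lia.
rewrite es in cardR_le *.
(* Split [(2s + 1) k] as [s (2k) + k] with [k = #|A| + #|R|]: [h1] bounds the first term, and
   [cardR_le] with [h2] bounds [s #|A| + k] by [(s + 1) chi G] plus the star degree. *)
have h1 : s * (2 * k) <= s * (#|G| + #|A|) by rewrite leq_mul2l; lia.
have h2 : (s + 1) * (#|A| + #|f @: R|) <= (s + 1) * chi G.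
  by rewrite leq_mul2l card_f orbT.
nia.
Qed.

Theorem proposition4 (t : nat) (ht : 3 <= t) (G : sgraph) (n g : nat)
  (hn : #|G| = n) (halpha : alpha G <= t) (hg : max_star_degree G t = g) :
  (2 * t - 3) * bstar G <= (t - 2) * n + (t - 1) * chi G + g * (t - 2).
Proof.
(* The bound for a single coloring has [g] with coefficient 1, which is at most [t - 2]. *)
have gt : g <= g * (t - 2) by rewrite leq_pmulr // subn_gt0.
rewrite /bstar; elim/big_ind: _ => [|x y lex ley|k /existsP[c bc]].
- by rewrite muln0.
- by rewrite maxnMr geq_max lex ley.
- apply: leq_trans (bstar_coloring_bound _ _ _ _ ht halpha bc) _.
  by rewrite hn hg leq_add2l.
Qed.
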